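(* Let $A$ and $B$ be algebras over a field $F$ with $\mathrm{char}(F)\neq 2$. Suppose that $\mathrm{Alg}([[A,A],[A,A]])=A$ and that $B$ is semiprime. Then every surjective Jordan homomorphism $J:A\to B$ is the sum of a homomorphism and an antihomomorphism.
   Context: Algebras are associative and not necessarily unital. For $x,y\in A$, $[x,y]=xy-yx$. $\mathrm{Alg}([[A,A],[A,A]])$ denotes the subalgebra of $A$ generated (without adjoining a unit) by all elements of the form $[[x,y],[z,w]]$ with $x,y,z,w\in A$. An algebra is semiprime if it has no nonzero nilpotent ideals. A Jordan homomorphism $J:A\to B$ is a linear map satisfying $J(yz+zy)=J(y)J(z)+J(z)J(y)$ for all $y,z\in A$. A homomorphism is a linear map $H$ with $H(xy)=H(x)H(y)$ for all $x,y$, and an antihomomorphism is a linear map $K$ with $K(xy)=K(y)K(x)$ for all $x,y$. A linear map $J:A\to B$ is said to be the sum of a homomorphism and an antihomomorphism if there exist ideals $U$ and $V$ of $\mathrm{Alg}(J(A))$ (the subalgebra of $B$ generated by the image of $J$), a homomorphism $H:A\to U$, and an antihomomorphism $K:A\to V$ such that $J=H+K$ and $UV=VU=\{0\}$. *)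

(* Defs.v *)
From HB Require Import structures.
From mathcomp Require Import all_boot all_algebra.
From mathcomp Require Import boolp classical_sets.

Set Implicit Arguments.
Unset Strict Implicit.
Unset Printing Implicit Defensive.

Import GRing.Theory.

Local Open Scope ring_scope.
Local Open Scope classical_set_scope.

(* MathComp's [algType F] is unital; the algebras here need not have a unit, so
   the product is a new operation [nmul] on a left [F]-module. *)
HB.mixin Record Lmodule_isNUAlgebra (F : fieldType) A of GRing.Lmodule F A := {
  nmul : A -> A -> A;
  nmulA : associative nmul;
  nmulDl : left_distributive nmul +%R;
  nmulDr : right_distributive nmul +%R;
  nscaleAl : forall (a : F) (x y : A), a *: nmul x y = nmul (a *: x) y;
  nscaleAr : forall (a : F) (x y : A), a *: nmul x y = nmul x (a *: y)
}.

#[short(type="nuAlgType")]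
HB.structure Definition NUAlgebra (F : fieldType) :=
  {A of Lmodule_isNUAlgebra F A & GRing.Lmodule F A}.

Notation "x ** y" := (nmul x y) (at level 40, left associativity) : ring_scope.

Definition ncomm (F : fieldType) (A : nuAlgType F) (x y : A) : A :=
  x ** y - y ** x.

Definition is_subspace (F : fieldType) (A : nuAlgType F) (S : set A) : Prop :=
  S 0 /\ forall (a : F) (x y : A), S x -> S y -> S (a *: x + y).

Definition is_subalg (F : fieldType) (A : nuAlgType F) (S : set A) : Prop :=
  is_subspace S /\ forall x y, S x -> S y -> S (x ** y).

Definition alg_gen (F : fieldType) (A : nuAlgType F) (G : set A) : set A :=
  smallest (@is_subalg F A) G.

Definition is_ideal_of (F : fieldType) (A : nuAlgType F) (R I : set A) : Prop :=
  [/\ I `<=` R, is_subspace I &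
      forall r x, R r -> I x -> I (r ** x) /\ I (x ** r)].

(* I J is the span of the products, not merely the set of products. *)
Definition mul_set (F : fieldType) (A : nuAlgType F) (I J : set A) : set A :=
  smallest (@is_subspace F A) [set u | exists x y, [/\ I x, J y & u = x ** y]].

(* [pow_set I n] is I^(n+1): without a unit there is no zeroth power. *)
Definition pow_set (F : fieldType) (A : nuAlgType F) (I : set A) (n : nat) :
  set A := iter n (fun K => mul_set K I) I.

Definition nilpotent_set (F : fieldType) (A : nuAlgType F) (I : set A) : Prop :=
  exists n, pow_set I n = [set 0].

Definition semiprime (F : fieldType) (A : nuAlgType F) : Prop :=
  forall I : set A, is_ideal_of setT I -> nilpotent_set I -> I = [set 0].

Definition is_jordan_hom (F : fieldType) (A B : nuAlgType F)
  (J : {linear A -> B}) : Prop :=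
  forall y z, J (y ** z + z ** y) = J y ** J z + J z ** J y.

Definition is_hom (F : fieldType) (A B : nuAlgType F)
  (H : {linear A -> B}) : Prop :=
  forall x y, H (x ** y) = H x ** H y.

Definition is_antihom (F : fieldType) (A B : nuAlgType F)
  (K : {linear A -> B}) : Prop :=
  forall x y, K (x ** y) = K y ** K x.

(* Maps into the ideals U and V are maps into B whose range lies in U, V. *)
Definition is_sum_hom_antihom (F : fieldType) (A B : nuAlgType F)
  (J : {linear A -> B}) : Prop :=
  exists (U V : set B) (H K : {linear A -> B}),
    [/\ is_ideal_of (alg_gen (range J)) U /\ is_ideal_of (alg_gen (range J)) V,
        is_hom H /\ range H `<=` U,
        is_antihom K /\ range K `<=` V,
        forall x, J x = H x + K x &
        mul_set U V = [set 0] /\ mul_set V U = [set 0]].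

(* Main.v *)
From HB Require Import structures.
Require Import Defs.
From mathcomp Require Import all_boot all_algebra.
From mathcomp Require Import boolp classical_sets.
Local Open Scope ring_scope.
Local Open Scope classical_set_scope.

(** Put [h x y = J (xy) - J x J y] and [k x y = J (xy) - J y J x].  Jordan
    identities give [h x y * b * k x y + k x y * b * h x y = 0] for all [b], and
    semiprimeness strengthens this to [h x y * b * k z w = 0] for all arguments.
    Hence the ideals [V] and [U] generated by the values of [h] and of [k]
    annihilate each other and intersect trivially.  Since
    [J [x, y] = h x y + k x y = 2 J (xy) - J x J y - J y J x], the preimage of
    [U + V] is a subalgebra of [A] containing all commutators, so it is [A] and
    [B] is the direct sum of [U] and [V].  Modulo [V] (resp. [U]) the map [J] is
    multiplicative (resp. antimultiplicative), so its two components are the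
    required maps. *)

Set Implicit Arguments.
Unset Strict Implicit.
Unset Printing Implicit Defensive.

Import GRing.Theory.

(** * Arithmetic without a unit *)

Section NonUnitalArithmetic.
Variables (F : fieldType) (A : nuAlgType F).
Implicit Types x y z : A.

Lemma nmul0x x : 0 ** x = 0.
Proof. by apply: (addIr (0 ** x)); rewrite -nmulDl !add0r. Qed.

Lemma nmulx0 x : x ** 0 = 0.
Proof. by apply: (addIr (x ** 0)); rewrite -nmulDr !add0r. Qed.

Lemma nmulNx x y : - x ** y = - (x ** y).
Proof. by apply: (addIr (x ** y)); rewrite -nmulDl !addNr nmul0x. Qed.

Lemma nmulxN x y : x ** - y = - (x ** y).
Proof. by apply: (addIr (x ** y)); rewrite -nmulDr !addNr nmulx0. Qed.

Lemma nmulBl x y z : (x - y) ** z = x ** z - y ** z.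
Proof. by rewrite nmulDl nmulNx. Qed.

Lemma nmulBr x y z : z ** (x - y) = z ** x - z ** y.
Proof. by rewrite nmulDr nmulxN. Qed.

Lemma double_eq0 x : 2%N \notin [pchar F] -> x + x = 0 -> x = 0.
Proof.
move=> charF /eqP; rewrite -mulr2n -scaler_nat scaler_eq0.
case/orP=> [two0|/eqP //]; by rewrite inE /= two0 in charF.
Qed.

End NonUnitalArithmetic.

(** * Two-sided ideals and annihilators *)

Section Ideals.
Variables (F : fieldType) (A : nuAlgType F).
Implicit Types (x y z r : A) (G I K S : set A).

Lemma subspaceD S x y : is_subspace S -> S x -> S y -> S (x + y).
Proof. by move=> [_ SD] Sx Sy; rewrite -[x]scale1r; apply: SD. Qed.

Lemma subspaceZ S (a : F) x : is_subspace S -> S x -> S (a *: x).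
Proof. by move=> [S0 SD] Sx; rewrite -[_ *: _]addr0; apply: SD. Qed.

Lemma subspaceB S x y : is_subspace S -> S x -> S y -> S (x - y).
Proof.
by move=> SS Sx Sy; rewrite -scaleN1r; apply: subspaceD => //; apply: subspaceZ.
Qed.

Lemma subspace_double S x : 2%N \notin [pchar F] -> is_subspace S ->
  S (x + x) -> S x.
Proof.
move=> charF SS Sxx; have -> : x = 2%:R^-1 *: (x + x); last exact: subspaceZ.
by rewrite -mulr2n -scaler_nat scalerA mulVf ?scale1r.
Qed.

Definition set_sum S K : set A := [set x | exists u v, [/\ S u, K v & x = u + v]].

Lemma set_sum_ideal I K : is_ideal_of setT I -> is_ideal_of setT K ->
  is_ideal_of setT (set_sum I K).
Proof.
move=> [_ sI IM] [_ sK KM]; have [I0 ID] := sI; have [K0 KD] := sK.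
split=> //.
  split=> [|a _ _ [u] [v] [Iu Kv ->] [u'] [v'] [Iu' Kv' ->]].
    by exists 0, 0; rewrite addr0.
  exists (a *: u + u'), (a *: v + v').
  by split; [exact: ID|exact: KD|rewrite scalerDr addrACA].
move=> r _ _ [u] [v] [Iu Kv ->].
have [? ?] := IM r u Logic.I Iu; have [? ?] := KM r v Logic.I Kv; split.
  by exists (r ** u), (r ** v); rewrite nmulDr.
by exists (u ** r), (v ** r); rewrite nmulDl.
Qed.

Definition ideal_gen G : set A := smallest (@is_ideal_of F A setT) G.

Lemma ideal_gen_ideal G : is_ideal_of setT (ideal_gen G).
Proof.
split=> //.
- split=> [I [[_ [I0 _] _] _] //|a x y Gx Gy I [idI GI]].
  have [_ [_ ID] _] := idI.
  by apply: ID; [apply: Gx|apply: Gy].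
- move=> r x _ Gx; split=> I [idI GI]; have [_ _ IM] := idI;
    by have [] := IM r x Logic.I (Gx I (conj idI GI)).
Qed.

Lemma sub_ideal_gen G : G `<=` ideal_gen G.
Proof. by move=> x Gx I [_]; apply. Qed.

Lemma ideal_gen_sub G I : is_ideal_of setT I -> G `<=` I -> ideal_gen G `<=` I.
Proof. by move=> idI GI x; apply. Qed.

Lemma mul_set_eq0 I K : (forall x y, I x -> K y -> x ** y = 0) ->
  mul_set I K = [set 0].
Proof.
move=> IK0; apply/seteqP; split=> [u|_ ->]; last by move=> S [[]].
apply; split=> [|_ [x] [y] [Ix Ky ->]]; last exact: IK0.
by split=> //= a x y -> ->; rewrite scaler0 addr0.
Qed.

(** The middle factor [b] makes this annihilator two-sided: a left factor [s] of [x] is absorbed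
    into [b]. *)
Lemma right_ann_ideal (G : set A) :
  is_ideal_of setT [set x | forall y b, G y -> y ** b ** x = 0].
Proof.
split=> //.
  split=> [y b _|a x y Hx Hy z b Gz]; first exact: nmulx0.
  by rewrite nmulDr -nscaleAr Hx // Hy // scaler0 addr0.
move=> s x _ Hx; split=> y b Gy; last by rewrite nmulA Hx // nmul0x.
by rewrite nmulA -(nmulA y) Hx.
Qed.

Lemma left_ann_ideal (G : set A) :
  is_ideal_of setT [set x | forall y b, G y -> x ** b ** y = 0].
Proof.
split=> //.
  split=> [y b _|a x y Hx Hy z b Gz]; first by rewrite !nmul0x.
  by rewrite !nmulDl -!nscaleAl Hx // Hy // scaler0 addr0.
move=> s x _ Hx; split=> y b Gy; last by rewrite -(nmulA x) Hx.
by rewrite -!nmulA (nmulA x) Hx // nmulx0.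
Qed.

(** Extend one side at a time: the right annihilator of [G1] is an ideal containing [G2], hence [y];
    then the left annihilator of [y] is an ideal containing [G1], hence [x]. *)
Lemma ideal_gen_ann (G1 G2 : set A) :
  (forall x b y, G1 x -> G2 y -> x ** b ** y = 0) ->
  forall x b y, ideal_gen G1 x -> ideal_gen G2 y -> x ** b ** y = 0.
Proof.
move=> G12 x b y G1x G2y.
have G1y z c : G1 z -> z ** c ** y = 0.
  move=> G1z; apply: (ideal_gen_sub (right_ann_ideal G1)) G2y _ _ G1z => w G2w.
  by move=> u d G1u; apply: G12.
apply: (ideal_gen_sub (left_ann_ideal [set y])) G1x _ _ _ => //.
by move=> z G1z _ d ->; apply: G1y.
Qed.

End Ideals.

(** * Elementwise consequences of semiprimeness *)

Section Semiprime.
Variables (F : fieldType) (B : nuAlgType F).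
Hypothesis semiprimeB : semiprime B.
Implicit Types (a b c w x y z : B) (I : set B).

Lemma semiprime_cube I : is_ideal_of setT I ->
  (forall x y z, I x -> I y -> I z -> x ** y ** z = 0) -> I = [set 0].
Proof.
(* Index 2 stands for the cube of [I]. *)
move=> idI I3; apply: semiprimeB => //; exists 2%N.
apply: mul_set_eq0 => u z Iu Iz.
apply: (Iu [set u | u ** z = 0]); split=> [|_ [x] [y] [Ix Iy ->]]; last exact: I3.
split=> /= [|a x y xz yz]; first exact: nmul0x.
by rewrite nmulDl -nscaleAl xz yz scaler0 addr0.
Qed.

(** The ideal generated by [c] has zero cube. The cube is used because, without a unit, the
    hypothesis does not directly give [c ** c = 0]; the middle factor of a triple product serves as
    [w]. *)
Lemma semiprime_elt c : (forall w, c ** w ** c = 0) -> c = 0.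
Proof.
move=> cBc.
have /seteqP[I0 _] : ideal_gen [set c] = [set 0].
  apply: semiprime_cube (ideal_gen_ideal _) _ => x y z Ix _ Iz.
  by apply: (ideal_gen_ann (G1 := [set c]) (G2 := [set c])) Ix Iz => _ b _ -> ->.
by apply: I0; apply: sub_ideal_gen.
Qed.

Lemma semiprime_mul_sym a c :
  (forall b, a ** b ** c = 0) -> forall b, c ** b ** a = 0.
Proof.
move=> aBc b; apply: semiprime_elt => w.
have -> : c ** b ** a ** w ** (c ** b ** a) = c ** b ** (a ** w ** c) ** b ** a.
  by rewrite !nmulA.
by rewrite aBc nmulx0 !nmul0x.
Qed.

Lemma semiprime_mul0 a c : (forall b, c ** b ** a = 0) -> a ** c = 0.
Proof.
move=> cBa; apply: semiprime_elt => w.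
have -> : a ** c ** w ** (a ** c) = a ** (c ** w ** a) ** c by rewrite !nmulA.
by rewrite cBa nmulx0 nmul0x.
Qed.

Lemma semiprime_skew a c : 2%N \notin [pchar F] ->
  (forall b, a ** b ** c + c ** b ** a = 0) -> forall b, a ** b ** c = 0.
Proof.
move=> charF skew b; apply: semiprime_elt => w.
have swap z : a ** z ** c = - (c ** z ** a).
  by apply/eqP; rewrite -addr_eq0 skew.
(* Moving [a] and [c] across in two ways gives
   [(a b c) w (a b c) = d] and [= - d]. *)
pose d := c ** b ** c ** w ** (a ** b ** a).
have eD : a ** b ** c ** w ** (a ** b ** c) = d.
  have := congr1 (fun u => u ** b ** a) (swap (b ** c ** w)).
  by rewrite /d {2}(swap b) nmulxN !nmulNx !nmulA => ->; rewrite opprK.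
have eN : a ** b ** c ** w ** (a ** b ** c) = - d.
  by have := swap (b ** c ** w ** a ** b); rewrite /d !nmulA.
by apply: (double_eq0 charF); rewrite [X in X + _]eD eN subrr.
Qed.

(** Linearizing gives [f u ** b ** g v = - (f v ** b ** g u)]. Substituting this for the second
    factor in [(f u ** b ** g v) ** w ** (f u ** b ** g v)] yields a product that starts with [f u]
    and ends with [g u], so it vanishes. *)
Lemma semiprime_polarize (V : zmodType) (f g : V -> B) :
  {morph f : u v / u + v} -> {morph g : u v / u + v} ->
  (forall u b, f u ** b ** g u = 0) -> forall u v b, f u ** b ** g v = 0.
Proof.
move=> fD gD fg u v b; apply: semiprime_elt => w.
have swap : f u ** b ** g v = - (f v ** b ** g u).
  apply/eqP; rewrite -addr_eq0; apply/eqP.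
  have := fg (u + v) b.
  by rewrite fD gD !nmulDl !nmulDr !fg add0r addr0.
rewrite {2}swap nmulxN -[RHS]oppr0; congr (- _).
have := fg u (b ** g v ** w ** f v ** b).
by rewrite !nmulA.
Qed.

End Semiprime.

(** * Identities for Jordan homomorphisms *)

Section JordanIdentities.
Variables (F : fieldType) (A B : nuAlgType F).
Hypothesis charF : 2%N \notin [pchar F].
Variable J : {linear A -> B}.
Hypothesis jordanJ : is_jordan_hom J.
Implicit Types x y z : A.

Definition hom_defect x y : B := J (x ** y) - J x ** J y.
Definition antihom_defect x y : B := J (x ** y) - J y ** J x.

Lemma double_inj : injective (fun b : B => b + b).
Proof.
move=> a b /= e; apply/eqP; rewrite -subr_eq0; apply/eqP/(double_eq0 charF).
by rewrite addrACA e -opprD subrr.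
Qed.

Lemma jordan_sqr x : J (x ** x) = J x ** J x.
Proof. by apply: double_inj; rewrite /= -linearD jordanJ. Qed.

Lemma jordan_triple x y : J (x ** y ** x) = J x ** J y ** J x.
Proof.
(* With [{u,v} = uv + vu], this is [2uvu = {u,{u,v}} - {u^2,v}], which writes [uvu] through
   operations that [J] preserves. It is needed in both algebras, hence the quantified [C]. *)
have dbl (C : nuAlgType F) (u v : C) : u ** v ** u + u ** v ** u =
    u ** (u ** v + v ** u) + (u ** v + v ** u) ** u
    - (u ** u ** v + v ** (u ** u)).
  by rewrite nmulDr nmulDl !nmulA [X in X + _ - _]addrC addrACA addrK.
by apply: double_inj; rewrite /= -linearD dbl -!jordan_sqr -!jordanJ -linearB -dbl.
Qed.

Lemma jordan_triple_lin x y z :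
  J (x ** y ** z + z ** y ** x) = J x ** J y ** J z + J z ** J y ** J x.
Proof.
have polar (C : nuAlgType F) (u v w : C) : u ** v ** w + w ** v ** u =
    (u + w) ** v ** (u + w) - (u ** v ** u + w ** v ** w).
  rewrite nmulDr !nmulDl [X in X + _ - _]addrC addrACA addrK; exact: addrC.
by rewrite [RHS]polar -!linearD -!jordan_triple -linearD -linearB -polar.
Qed.

Lemma jordan_swap x y : J (y ** x) = J x ** J y + J y ** J x - J (x ** y).
Proof. by rewrite -jordanJ linearD /= addrAC subrr add0r. Qed.

Lemma jordan_comm x y :
  J (ncomm x y) = hom_defect x y + antihom_defect x y.
Proof.
rewrite /ncomm linearB /= (jordan_swap x y) opprB /hom_defect /antihom_defect.
by rewrite [RHS]addrACA -opprD addrA.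
Qed.

Lemma jordan_defect_skew x y z :
  hom_defect x y ** J z ** antihom_defect x y +
  antihom_defect x y ** J z ** hom_defect x y = 0.
Proof.
set p := J (x ** y); set q := J (y ** x); set c := J z.
pose a := J x ** J y; pose b := J y ** J x.
have kE : antihom_defect x y = a - q.
  by rewrite /antihom_defect /a /q (jordan_swap x y) opprB opprD addrCA addNKr.
(* [J] of [(xy) z (yx) + (yx) z (xy) = x (y z y) x + y (x z x) y]. *)
have pq : p ** c ** q + q ** c ** p = a ** c ** b + b ** c ** a.
  rewrite /p /q /c -jordan_triple_lin.
  have -> : x ** y ** z ** (y ** x) + y ** x ** z ** (x ** y) =
            x ** (y ** z ** y) ** x + y ** (x ** z ** x) ** y by rewrite !nmulA.
  by rewrite linearD /= !jordan_triple /a /b !nmulA.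
(* Since [p + q = a + b], the antihomomorphism defect is both [a - q] and [p - b]. The first form is
   used next to [p] and the second next to [a], so that the mixed terms [pca] and [acp] cancel in
   the sum and [pq] finishes. *)
have hck : hom_defect x y ** c ** antihom_defect x y =
           (p ** c ** a + a ** c ** b) - (a ** c ** p + p ** c ** q).
  rewrite /hom_defect !nmulBl {1}kE -/p -/a !nmulBr opprB.
  by rewrite addrACA -opprD [X in _ - X]addrC.
have kch : antihom_defect x y ** c ** hom_defect x y =
           (a ** c ** p + b ** c ** a) - (p ** c ** a + q ** c ** p).
  rewrite /hom_defect nmulBr {1}kE -/p -/a !nmulBl opprB.
  by rewrite addrACA -opprD [X in _ - X]addrC.
rewrite hck kch addrACA -opprD [X in _ - X]addrACA pq.
by rewrite addrACA [X in X + _ - _]addrC subrr.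
Qed.

End JordanIdentities.

(** * Splitting a linear map along a direct sum, and the theorem *)

Lemma packed_linear (F : fieldType) (A B : nuAlgType F) (f : A -> B) :
  (forall (a : F) x y, f (a *: x + y) = a *: f x + f y) ->
  exists g : {linear A -> B}, g =1 f.
Proof.
move=> flin; pose m := GRing.isLinear.Build F A B *:%R f flin.
by exists (HB.pack_for {linear A -> B} f m).
Qed.

(** The components are picked by choice; uniqueness of the decomposition makes them linear. *)
Lemma linear_direct_sum (F : fieldType) (A B : nuAlgType F) (U V : set B)
    (J : {linear A -> B}) :
  is_subspace U -> is_subspace V -> (forall b, U b -> V b -> b = 0) ->
  (forall x, set_sum U V (J x)) ->
  exists H K : {linear A -> B},
    [/\ forall x, U (H x), forall x, V (K x) & forall x, J x = H x + K x].
Proof.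
move=> sU sV UV0 JUV.
have [H HP] := choice JUV; have [K HKP] := choice HP.
have uniqUV u v u' v' : U u -> V v -> U u' -> V v' ->
    u + v = u' + v' -> u = u' /\ v = v'.
  move=> Uu Vv Uu' Vv' e.
  have d : u - u' = v' - v.
    by apply/eqP; rewrite subr_eq addrAC eq_sym subr_eq e addrC.
  have d0 : u - u' = 0.
    by apply: UV0; [|rewrite d]; apply: subspaceB.
  by split; apply/eqP; [|rewrite eq_sym]; rewrite -subr_eq0 -?d d0.
have HKlin a x y : H (a *: x + y) = a *: H x + H y /\
                   K (a *: x + y) = a *: K x + K y.
  have [[UHx VKx ex] [UHy VKy ey]] := (HKP x, HKP y).
  have [UHz VKz ez] := HKP (a *: x + y).
  apply: uniqUV => //; [exact: sU.2|exact: sV.2|].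
  by rewrite -ez linearP ex ey scalerDr addrACA.
have [H' H'E] := packed_linear (fun a x y => (HKlin a x y).1).
have [K' K'E] := packed_linear (fun a x y => (HKlin a x y).2).
by exists H', K'; split=> x; have [? ? ?] := HKP x; rewrite ?H'E ?K'E.
Qed.

Theorem theorem3p1 (F : fieldType) (A B : nuAlgType F)
  (charF : 2%N \notin [pchar F])
  (genA : alg_gen [set u : A | exists x y z w : A,
                     u = ncomm (ncomm x y) (ncomm z w)] = setT)
  (semiprimeB : semiprime B)
  (J : {linear A -> B}) (jordanJ : is_jordan_hom J)
  (surjJ : forall b : B, exists a : A, J a = b) :
  is_sum_hom_antihom J.
Proof.
pose h := hom_defect J; pose k := antihom_defect J.
have hDl y : {morph h^~ y : u v / u + v}.
  by move=> u v; rewrite /h /hom_defect nmulDl !linearD /= nmulDl opprD addrACA.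
have hDr x : {morph h x : u v / u + v}.
  by move=> u v; rewrite /h /hom_defect nmulDr !linearD /= nmulDr opprD addrACA.
have kDl y : {morph k^~ y : u v / u + v}.
  by move=> u v; rewrite /k /antihom_defect nmulDl !linearD /= nmulDr opprD addrACA.
have kDr x : {morph k x : u v / u + v}.
  by move=> u v; rewrite /k /antihom_defect nmulDr !linearD /= nmulDl opprD addrACA.
(* Polarize in the second arguments, then in the first ones, to reduce to [u = x] and [v = y];
   surjectivity turns [b] into some [J z]. *)
have hk x y u v b : h x y ** b ** k u v = 0.
  apply: (semiprime_polarize semiprimeB (hDr x) (kDr u)) => {}y {}b.
  apply: (semiprime_polarize semiprimeB (hDl y) (kDl y)) => {}x {}b.
  apply: semiprime_skew => // {}b; have [z <-] := surjJ b.
  exact: jordan_defect_skew.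
pose GU := [set u : B | exists x y, u = k x y].
pose GV := [set u : B | exists x y, u = h x y].
pose U := ideal_gen GU; pose V := ideal_gen GV.
have idU : is_ideal_of setT U by exact: ideal_gen_ideal.
have idV : is_ideal_of setT V by exact: ideal_gen_ideal.
have [_ sU UM] := idU; have [_ sV VM] := idV.
have Uk x y : U (k x y) by apply: sub_ideal_gen; exists x, y.
have Vh x y : V (h x y) by apply: sub_ideal_gen; exists x, y.
have VBU v b u : V v -> U u -> v ** b ** u = 0.
  by apply: ideal_gen_ann => {}v {}b {}u [x [y ->]] [z [w ->]].
have UV0 u v : U u -> V v -> u ** v = 0.
  by move=> Uu Vv; apply: (semiprime_mul0 semiprimeB) => b; apply: VBU.
(* [semiprime_mul0] reverses the order of the factors, so [VBU = 0] is first turned into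
   [UBV = 0]. *)
have VU0 v u : V v -> U u -> v ** u = 0.
  move=> Vv Uu; apply: (semiprime_mul0 semiprimeB).
  by apply: (semiprime_mul_sym semiprimeB) => b; apply: VBU.
have UV_disj x : U x -> V x -> x = 0.
  move=> Ux Vx; apply: (semiprime_elt semiprimeB) => w.
  by apply: UV0 => //; have [] := UM w x Logic.I Ux.
have idW := set_sum_ideal idU idV.
have [_ sW WM] := idW; have [W0 WD] := sW.
have Whk x y : set_sum U V (h x y + k x y).
  by exists (k x y), (h x y); rewrite addrC.
have JW a : set_sum U V (J a).
  suff : alg_gen [set u : A | exists x y z w : A,
      u = ncomm (ncomm x y) (ncomm z w)] a.
    move/(_ [set a | set_sum U V (J a)]); apply.
    split=> [|_ [x] [y] [z] [w] -> /=]; last first.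
      by rewrite jordan_comm //; apply: Whk.
    split; [split|] => /= [|c x y Wx Wy|x y Wx Wy]; first by rewrite linear0.
    - by rewrite linearP; apply: WD.
    (* Closure under products: [2 J (xy)] is [h x y + k x y] plus products of [J x] and [J y], which
       stay in the ideal [U + V]. *)
    - apply: (subspace_double charF sW).
      have -> : J (x ** y) + J (x ** y) =
                h x y + k x y + (J x ** J y + J y ** J x).
        by rewrite /h /k /hom_defect /antihom_defect [X in _ = X + _]addrACA -opprD subrK.
      apply: (subspaceD sW) => //.
      by apply: (subspaceD sW); [have [] := WM (J x) (J y)|have [] := WM (J y) (J x)].
  by rewrite genA.
have [H [K [UH VK JHK]]] := linear_direct_sum sU sV UV_disj JW.
have HK x y : J x ** J y = H x ** H y + K x ** K y.
  by rewrite !JHK nmulDl !nmulDr (UV0 (H x) (K y)) // (VU0 (K x) (H y)) // addr0 add0r.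
have genT : alg_gen (range J) = setT.
  apply/seteqP; split=> // b _ S [_ JS]; have [a <-] := surjJ b.
  by apply: JS; exists a.
exists U, V, H, K; split=> //; rewrite ?genT //.
- split=> [x y|_ [x _ <-] //].
  (* The multiplicativity defect of [H] lies in [U]; it also lies in [V], being [h x y] minus the
     corresponding expression in [K]. *)
  apply/eqP; rewrite -subr_eq0; apply/eqP; apply: UV_disj.
    by apply: (subspaceB sU) => //; have [] := UM (H x) (H y) Logic.I (UH y).
  have -> : H (x ** y) - H x ** H y = h x y - (K (x ** y) - K x ** K y).
    by rewrite /h /hom_defect HK JHK opprD addrACA addrK.
  apply: (subspaceB sV) => //; apply: (subspaceB sV) => //.
  by have [] := VM (K x) (K y) Logic.I (VK y).
- split=> [x y|_ [x _ <-] //].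
  (* Dually, with [k x y] in [U] and the factors reversed. *)
  apply/eqP; rewrite -subr_eq0; apply/eqP; apply: UV_disj; last first.
    by apply: (subspaceB sV) => //; have [] := VM (K y) (K x) Logic.I (VK x).
  have -> : K (x ** y) - K y ** K x = k x y - (H (x ** y) - H y ** H x).
    by rewrite /k /antihom_defect HK JHK opprD addrACA [RHS]addrAC subrr add0r.
  apply: (subspaceB sU) => //; apply: (subspaceB sU) => //.
  by have [] := UM (H y) (H x) Logic.I (UH x).
- by split; apply: mul_set_eq0.
Qed.
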